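(* Let $\Gamma$ be a finite dynamic game with ordinal preferences and perfect recall. There exists a profile $u^*=(u^*_j)_{j\in I}$ with $u^*_j\in\mathcal U_j$ for every $j\in I$ such that $\mathbb U^k_i(S)=\mathrm{SR}^k_i(S)[u^*]$ for every $i\in I$ and every $k\in\mathbb N$ (where $\mathbb U^k_i(S)$, $\mathrm{SR}^k_i(S)[u^*]$ denote the $i$-th components of $\mathbb U^k(S)$, $\mathrm{SR}^k(S)[u^*]$).
   Context: A finite dynamic game with ordinal preferences and perfect recall $\Gamma$ consists of: a finite set of players $I$; a finite rooted tree of histories (finite sequences of action profiles, simultaneous moves allowed) with terminal histories $Z$; for each $i$ a partition $H_i$ of the non-terminal histories where $i$ is active (at least two actions) into information sets with identical available actions; perfect recall; complete transitive preferences $\succsim_i$ on $Z$ (asymmetric part $\succ_i$). Strategies of $i$ are equivalence classes of behaviorally equivalent standard strategies (action assignments to $H_i$, identified when they allow the same information sets and prescribe the same actions there); $S_i$ is the finite set of strategies, $S=\prod_jS_j$, $S_{-i}=\prod_{j\ne i}S_j$, $\zeta:S\to Z$ the outcome map. For $h\in H_i$, $S_i(h)$, $S_{-i}(h)$ are strategies of $i$, resp. profiles of others, reaching $h$; $H_i(s_i)=\{h\in H_i:s_i\in S_i(h)\}$. A restriction is a nonempty $R=\prod_jR_j\subseteq S$; $R_i(h)=R_i\cap S_i(h)$, $R_{-i}(h)=R_{-i}\cap S_{-i}(h)$, $R^i(h)=R_i(h)\times R_{-i}(h)$. For $P=P_i\times P_{-i}$, $s_i\in P_i$ is weakly dominated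 relative to $P$ by $t_i\in P_i$ if $\zeta(t_i,s_{-i})\succsim_i\zeta(s_i,s_{-i})$ for all $s_{-i}\in P_{-i}$ with $\succ_i$ for some; B-dominated w.r.t. $P$ if for every nonempty $Q_{-i}\subseteq P_{-i}$ it is weakly dominated relative to $P_i\times Q_{-i}$ by some strategy in $P_i$. $s_i\in R_i$ is conditionally B-dominated w.r.t. $R$ if some $h\in H_i(s_i)$ has $R^i(h)\ne\emptyset$ and $s_i$ B-dominated w.r.t. $R^i(h)$. $\mathbb U_i(R)$: the $s_i\in R_i$ not conditionally B-dominated w.r.t. $R$; $\mathbb U(R)=\prod_j\mathbb U_j(R)$; $\mathbb U^0(S)=S$, $\mathbb U^n(S)=\mathbb U(\mathbb U^{n-1}(S))$. $\mathcal U_i$ is the set of $u_i:Z\to\mathbb R$ with $u_i(z)\ge u_i(z')\iff z\succsim_iz'$. $\mathcal H_i=\{S_{-i}(h):h\in H_i\}$; a CPS on $(S_{-i},\mathcal H_i)$ is a family of probability measures $\mu_i(\cdot\mid E)$ on $S_{-i}$, $E\in\mathcal H_i$, with $\mu_i(E\mid E)=1$ and $\mu_i(A\mid E)=\mu_i(A\mid E')\mu_i(E'\mid E)$ whenever $A\subseteq E'\subseteq E$; $\Delta^{\mathcal H_i}(R_{-i})$ is the set of CPSs with $\mu_i(R_{-i}(h)\mid S_{-i}(h))=1$ for every $h\in H_i$ with $R^i(h)\ne\emptyset$. Strong Rationalizability for a fixed profile $u=(u_j)$, $u_j\in\mathcal U_j$: $\mathrm{SR}_i(R)[u]$ is the set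 of $s^*_i\in R_i$ for which there is $\mu_i\in\Delta^{\mathcal H_i}(R_{-i})$ such that for every $h\in H_i(s^*_i)$ with $R^i(h)\ne\emptyset$, $s^*_i$ maximizes $s_i\mapsto\sum_{s_{-i}\in R_{-i}}u_i(\zeta(s_i,s_{-i}))\mu_i(\{s_{-i}\}\mid S_{-i}(h))$ over $s_i\in R_i(h)$; $\mathrm{SR}(R)[u]=\prod_j\mathrm{SR}_j(R)[u]$, $\mathrm{SR}^0(S)[u]=S$, $\mathrm{SR}^n(S)[u]=\mathrm{SR}(\mathrm{SR}^{n-1}(S)[u])[u]$. *)

(* Defs.v *)
From HB Require Import structures.
From mathcomp Require Import all_boot all_order all_algebra.
From mathcomp Require Import boolp reals.

(*  - lab i h = Some x : history h belongs to information set x of i        *)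
(*  - pref i : the preference relation of i (meaningful on terminal hist.)  *)
Record gdata := GData {
  player : finType;
  Act : finType;
  Info : finType;
  depth : nat;
  avail : seq {ffun player -> Act} -> player -> {set Act};
  owner : Info -> player;
  act_at : Info -> {set Act};
  lab : player -> seq {ffun player -> Act} -> option Info;
  pref : player -> rel (seq {ffun player -> Act})
}.

Set Implicit Arguments.
Unset Strict Implicit.
Unset Printing Implicit Defensive.
Import Order.TTheory GRing.Theory Num.Theory.
Local Open Scope ring_scope.

Section GameDefs.
Variable G : gdata.

Definition prof := {ffun player G -> Act G}.
Definition hist := seq prof.

Fixpoint hist_from (past rest : hist) : bool :=
  match rest with
  | [::] => true
  | a :: r => [forall j, a j \in avail G past j] && hist_from (rcons past a) r
  end.
Definition is_hist (h : hist) := hist_from [::] h.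
Definition nonterm (h : hist) := [forall j, avail G h j != set0].
Definition terminal (h : hist) := is_hist h && [forall j, avail G h j == set0].
Definition active (i : player G) (h : hist) := (1 < #|avail G h i|)%N.

Fixpoint exp_from (i : player G) (past rest : hist) : seq (Info G * Act G) :=
  match rest with
  | [::] => [::]
  | a :: r => (if lab G i past is Some x then [:: (x, a i)] else [::])
                ++ exp_from i (rcons past a) r
  end.
Definition experience i h := exp_from i [::] h.

Record is_game : Prop := IsGame {
  g_dichot : forall h, is_hist h -> nonterm h \/ terminal h;
  g_finite : forall h, is_hist h -> (depth G <= size h)%N -> terminal h;
  g_lab : forall i h, (lab G i h != None) = [&& is_hist h, nonterm h & active i h];
  g_owner : forall i h x, lab G i h = Some x -> owner G x = i;
  g_act : forall i h x, lab G i h = Some x -> avail G h i = act_at G x;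
  (* every information set label is used (information sets are nonempty) *)
  g_used : forall x, exists h, lab G (owner G x) h = Some x;
  g_recall : forall i h h' x, lab G i h = Some x -> lab G i h' = Some x ->
                experience i h = experience i h';
  g_complete : forall i z z', terminal z -> terminal z' ->
                 pref G i z z' || pref G i z' z;
  g_trans : forall i z1 z2 z3, terminal z1 -> terminal z2 -> terminal z3 ->
                 pref G i z1 z2 -> pref G i z2 z3 -> pref G i z1 z3
}.

Definition std := {ffun Info G -> option (Act G)}.
Definition valid_std (i : player G) (s : std) : bool :=
  [forall x, if owner G x == i then (if s x is Some a then a \in act_at G x else false)
             else s x == None].
Definition sprofile := {ffun player G -> std}.

Definition step (sg : sprofile) (h : hist) : hist :=
  match [pick a : prof | [forall j, a j \in avail G h j] &&
          [forall j, if lab G j h is Some x then sg j x == Some (a j) else true]] with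
  | Some a => rcons h a
  | None => h
  end.
Definition zeta_std (sg : sprofile) : hist := iter (depth G) (step sg) [::].

Definition passes (z : hist) (x : Info G) : bool :=
  [exists n : 'I_(size z).+1, lab G (owner G x) (take n z) == Some x].

Definition allows (i : player G) (s : std) (x : Info G) : bool :=
  [exists sg : sprofile, [&& sg i == s, [forall j, valid_std j (sg j)] &
                            passes (zeta_std sg) x]].
Definition std_equiv (i : player G) (s t : std) : bool :=
  [forall x, (owner G x == i) ==>
     ((allows i s x == allows i t x) && (allows i s x ==> (s x == t x)))].

Definition strat := {set std}.
Definition cls (i : player G) (s : std) : strat :=
  [set t | valid_std i t && std_equiv i s t].
Definition Sset (i : player G) : {set strat} :=
  [set cls i s | s in [set s | valid_std i s]].

Definition sprof := {ffun player G -> strat}.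
(* outcome map zeta : S -> Z (through any representatives) *)
Definition zeta (P : sprof) : hist :=
  match [pick sg : sprofile | [forall j, sg j \in P j]] with
  | Some sg => zeta_std sg
  | None => [::]
  end.

(* a profile s_{-i} of the others is encoded as a full profile with
   the (dummy) empty set at coordinate i *)
Definition join (i : player G) (s : strat) (p : sprof) : sprof :=
  [ffun j => if j == i then s else p j].
Definition Sminus (i : player G) : {set sprof} :=
  [set p : sprof | (p i == set0) && [forall j, (j != i) ==> (p j \in Sset j)]].

Definition Si (i : player G) (x : Info G) : {set strat} :=
  [set s in Sset i | [exists p in Sminus i, passes (zeta (join i s p)) x]].
Definition Smi (i : player G) (x : Info G) : {set sprof} :=
  [set p in Sminus i | [exists s in Sset i, passes (zeta (join i s p)) x]].

Definition rstr := player G -> {set strat}.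
Definition Rminus (i : player G) (R : rstr) : {set sprof} :=
  [set p : sprof | (p i == set0) && [forall j, (j != i) ==> (p j \in R j)]].
Definition Ri (i : player G) (R : rstr) x := R i :&: Si i x.
Definition Rmi (i : player G) (R : rstr) x := Rminus i R :&: Smi i x.
Definition Rne (i : player G) (R : rstr) x := (Ri i R x != set0) && (Rmi i R x != set0).

Definition spref (i : player G) (z z' : hist) := pref G i z z' && ~~ pref G i z' z.
Definition wdom (i : player G) (Q : {set sprof}) (s t : strat) : bool :=
  [forall p in Q, pref G i (zeta (join i t p)) (zeta (join i s p))] &&
  [exists p in Q, spref i (zeta (join i t p)) (zeta (join i s p))].
Definition bdom (i : player G) (Pi : {set strat}) (Pm : {set sprof}) (s : strat) : bool :=
  [forall Q : {set sprof}, ((Q != set0) && (Q \subset Pm)) ==>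
     [exists t in Pi, wdom i Q s t]].
Definition condB (i : player G) (R : rstr) (s : strat) : bool :=
  [exists x, [&& owner G x == i, s \in Si i x, Rne i R x &
                 bdom i (Ri i R x) (Rmi i R x) s]].
Definition Uop (R : rstr) : rstr := fun i => [set s in R i | ~~ condB i R s].
Definition Uiter (k : nat) : rstr := iter k Uop Sset.

Section Reals.
Variable Rl : realType.

Definition is_ordrep (i : player G) (v : hist -> Rl) : Prop :=
  forall z z', terminal z -> terminal z' -> (v z' <= v z <-> pref G i z z').

Definition Hsets (i : player G) : {set {set sprof}} :=
  [set Smi i x | x in [set x | owner G x == i]].
(* a CPS: mu E is the measure conditional on E (given by point masses on S_{-i}) *)
Definition mu_of (mu : {set sprof} -> sprof -> Rl) (E A : {set sprof}) : Rl :=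
  \sum_(p in A) mu E p.
Definition is_cps (i : player G) (mu : {set sprof} -> sprof -> Rl) : Prop :=
  forall E, E \in Hsets i ->
    [/\ (forall p, p \in Sminus i -> 0 <= mu E p),
        mu_of mu E (Sminus i) = 1,
        mu_of mu E E = 1 &
        forall E' (A : {set sprof}), E' \in Hsets i -> E' \subset E -> A \subset E' ->
          mu_of mu E A = mu_of mu E' A * mu_of mu E E'].
Definition in_Delta (i : player G) (R : rstr) mu : Prop :=
  is_cps i mu /\
  forall x, owner G x = i -> Rne i R x -> mu_of mu (Smi i x) (Rmi i R x) = 1.
Definition EU (u : player G -> hist -> Rl) (i : player G) (R : rstr) mu x (s : strat) : Rl :=
  \sum_(p in Rminus i R) u i (zeta (join i s p)) * mu (Smi i x) p.
Definition SRop (u : player G -> hist -> Rl) (R : rstr) : rstr := fun i =>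
  [set s in R i | `[< exists mu, in_Delta i R mu /\
      forall x, owner G x = i -> s \in Si i x -> Rne i R x ->
        forall t, t \in Ri i R x -> EU u i R mu x t <= EU u i R mu x s >]].
Definition SRiter (u : player G -> hist -> Rl) (k : nat) : rstr := iter k (SRop u) Sset.
End Reals.
End GameDefs.

(* Main.v *)
Require Import Defs.
From HB Require Import structures.
From mathcomp Require Import all_boot all_order all_algebra.
From mathcomp Require Import boolp reals.
From mathcomp Require Import zify.
Import Order.TTheory GRing.Theory Num.Theory.

(* Take extremely risk averse utilities, - B ^- rank with B large. If s is not
   weakly dominated on a set Q of opponents' profiles, the belief on Q weighting
   p by B ^ rank (outcome of (s, p)) makes every possible loss from deviating
   cost more than all possible gains together, so s is a best reply to it; the
   converse implication only needs the utilities to be ordinal. This gives, for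
   s in U(R) with R = U^n(S) = SR^n(S), a belief at each information set
   separately, and these must be fitted into one conditional probability system.

   Conditional systems are read off from lists of weights: on an event,
   condition the first weight that charges it. Going through the information
   sets that s reaches, in an order refining precedence, a new weight is appended
   at h only when the list charges no profile reaching h; at the others
   optimality is inherited from an earlier information set by strategy
   replacement. Inheritance needs s to be optimal at h among all strategies
   reaching h and not only among those in R. For that, let b be
   lexicographically optimal, for the new weight followed by the indicators of
   R^n, ..., R^0, among the strategies reaching h that have the same outcomes as s
   on the support of the list. Then b is a sequential best reply to the list so
   completed, hence survives n rounds of SR, and s does at least as well as b. *)

(** * Plays of standard strategy profiles and consequences of perfect recall *)

Section Plays.
Set Implicit Arguments.
Unset Strict Implicit.
Variable G : gdata.

Definition play (sg : sprofile G) n : hist G := iter n (step sg) [::].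
Definition validp (sg : sprofile G) := [forall j, valid_std j (sg j)].

Lemma hist_from_rcons past (h : hist G) a :
  hist_from past (rcons h a)
  = hist_from past h && [forall j, a j \in avail G (past ++ h) j].
Proof.
elim: h past => [|b h IHh] past /=; first by rewrite cats0 andbT.
by rewrite IHh cat_rcons andbA.
Qed.

Lemma is_hist_rcons (h : hist G) a :
  is_hist (rcons h a) = is_hist h && [forall j, a j \in avail G h j].
Proof. exact: hist_from_rcons. Qed.

Lemma is_hist_take n (h : hist G) : is_hist h -> is_hist (take n h).
Proof.
elim/last_ind: h => [//|h a IHh]; rewrite is_hist_rcons => /andP[hh ha].
rewrite -cats1 take_cat; case: ltnP => _; first exact: IHh.
by case: (n - size h)%N => [|m] /=; rewrite ?cats0 // cats1 is_hist_rcons hh.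
Qed.

Lemma exp_from_rcons i past (h : hist G) a :
  exp_from i past (rcons h a)
  = exp_from i past h ++ (if lab G i (past ++ h) is Some x then [:: (x, a i)] else [::]).
Proof.
elim: h past => [|b h IHh] past /=; first by rewrite cats0 cats0.
by rewrite IHh cat_rcons catA.
Qed.

Lemma experience_rcons i (h : hist G) a :
  experience i (rcons h a)
  = experience i h ++ (if lab G i h is Some x then [:: (x, a i)] else [::]).
Proof. exact: exp_from_rcons. Qed.

Lemma experience_cat i (h t : hist G) :
  exists e, experience i (h ++ t) = experience i h ++ e.
Proof.
elim/last_ind: t => [|t a [e eE]]; first by exists [::]; rewrite !cats0.
by rewrite -rcons_cat experience_rcons eE -catA; eexists.
Qed.

Lemma experience_cat_cons i (h t : hist G) a x : lab G i h = Some x ->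
  exists e, experience i (h ++ a :: t) = experience i h ++ (x, a i) :: e.
Proof.
move=> lx; rewrite -cat_rcons; have [e ->] := experience_cat i (rcons h a) t.
by exists e; rewrite experience_rcons lx -catA.
Qed.

Lemma experienceP i (h : hist G) x b : (x, b) \in experience i h ->
  exists h1 a t, [/\ h = h1 ++ a :: t, lab G i h1 = Some x & b = a i].
Proof.
elim/last_ind: h => [//|h a IHh]; rewrite experience_rcons mem_cat => /orP[].
  move=> /IHh[h1 [a' [t [-> lx ->]]]].
  by exists h1, a', (rcons t a); rewrite -rcons_cons -rcons_cat.
case lx: (lab G i h) => [y|//]; rewrite inE => /eqP[-> ->].
by exists h, a, [::]; rewrite cats1.
Qed.

Variant step_spec (sg : sprofile G) (h : hist G) : hist G -> Prop :=
  | StepMove (a : prof G) of (forall j, a j \in avail G h j) &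
      (forall j x, lab G j h = Some x -> sg j x = Some (a j)) :
      step_spec sg h (rcons h a)
  | StepStay of (forall a : prof G, (forall j, a j \in avail G h j) ->
      (forall j x, lab G j h = Some x -> sg j x = Some (a j)) -> False) :
      step_spec sg h h.

Lemma stepP sg h : step_spec sg h (step sg h).
Proof.
rewrite /step; case: pickP => [a /andP[/forallP av /forallP ls]|no].
  by constructor=> // j x lx; move: (ls j); rewrite lx => /eqP.
constructor=> a av ls; move: (no a); rewrite (introT forallP av) /=.
by move/negP; apply; apply/forallP => j; case lx: (lab G j h) => [x|//]; apply/eqP/ls.
Qed.

Lemma step_agree (sg sg' : sprofile G) h :
  (forall j x, lab G j h = Some x -> sg j x = sg' j x) -> step sg' h = step sg h.
Proof.
move=> ag; rewrite /step; congr (match _ with Some _ => _ | None => _ end).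
apply: eq_pick => a; congr andb; apply: eq_forallb => j.
by case lx: (lab G j h) => [x|//]; rewrite (ag _ _ lx).
Qed.

Lemma playS sg n : play sg n.+1 = step sg (play sg n).
Proof. by []. Qed.

Lemma play_hist sg n : is_hist (play sg n).
Proof.
elim: n => [//|n IHn]; rewrite playS; case: stepP => [a av _|//].
by rewrite is_hist_rcons IHn; apply/forallP.
Qed.

Lemma play_agree (sg sg' : sprofile G) n :
  (forall m j x, (m < n)%N -> lab G j (play sg m) = Some x -> sg j x = sg' j x) ->
  play sg' n = play sg n.
Proof.
elim: n => [//|n IHn] ag; rewrite !playS IHn.
  by apply: step_agree => j x; apply: ag.
by move=> m j x mn; apply: ag; apply: ltnW.
Qed.

Lemma play_prefix sg n k : (k <= size (play sg n))%N ->
  exists2 m, (m <= n)%N & take k (play sg n) = play sg m.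
Proof.
elim: n k => [|n IHn] k; first by exists 0%N; rewrite ?take_nil.
have [kn _|kn] := leqP k (size (play sg n)).
  have [m mn mE] := IHn _ kn; exists m; first exact: leqW.
  rewrite -mE playS; case: stepP => [a _ _|//].
  by rewrite -cats1 takel_cat.
by move=> kn1; exists n.+1 => //; rewrite take_oversize//; move: kn1;
  rewrite playS; case: stepP => [a _ _|]; rewrite ?size_rcons; lia.
Qed.

Lemma play_take sg m n : (m <= n)%N -> take (size (play sg m)) (play sg n) = play sg m.
Proof.
elim: n => [|n IHn]; first by rewrite leqn0 => /eqP->.
rewrite leq_eqVlt => /orP[/eqP->|mn]; first by rewrite take_size.
rewrite playS; case: stepP => [a _ _|_]; last exact: IHn.
rewrite -cats1 takel_cat ?IHn//.
by rewrite -[X in (size X <= _)%N](IHn mn) size_take; case: ltnP => // /ltnW.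
Qed.

Lemma passesP sg (x : Info G) :
  reflect (exists2 m, (m <= depth G)%N & lab G (owner G x) (play sg m) = Some x)
          (passes (zeta_std sg) x).
Proof.
apply: (iffP existsP) => [[[n nz] /= /eqP]|[m mD lx]].
  by have [m mD ->] := @play_prefix sg (depth G) n nz; exists m.
have sm : (size (play sg m) < (size (zeta_std sg)).+1)%N.
  rewrite ltnS -[X in (size X <= _)%N](play_take sg mD) size_take.
  by case: ltnP => // /ltnW.
by exists (Ordinal sm); rewrite /= play_take// lx.
Qed.

Hypothesis gG : is_game G.

Lemma lab_facts i h x : lab G i h = Some x ->
  [/\ is_hist h, nonterm h, active i h, owner G x = i & avail G h i = act_at G x].
Proof.
move=> lx; have := g_lab gG i h; rewrite lx => /esym/and3P[-> -> ->].
by rewrite (g_owner gG lx) (g_act gG lx).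
Qed.

Lemma valid_act sg i h x : validp sg -> lab G i h = Some x ->
  exists2 a, sg i x = Some a & a \in avail G h i.
Proof.
move=> /forallP/(_ i)/forallP/(_ x) + lx.
have [_ _ _ -> ->] := lab_facts lx; rewrite eqxx.
by case: (sg i x) => [a|//] ?; exists a.
Qed.

Lemma step_nonterm sg h : validp sg -> is_hist h -> nonterm h ->
  exists a, [/\ step sg h = rcons h a, (forall j, a j \in avail G h j) &
    forall j x, lab G j h = Some x -> sg j x = Some (a j)].
Proof.
move=> vsg hh /forallP nt; case: stepP => [a av ls|]; first by exists a.
have ch j : exists a, a \in avail G h j /\
    forall x, lab G j h = Some x -> sg j x = Some a.
  case lx: (lab G j h) => [x|]; last by have /set0Pn[a aP] := nt j; exists a.
  by have [a sa aP] := valid_act vsg lx; exists a; split=> // _ [<-].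
have [f fP] := choice ch.
by case/(_ [ffun j => f j]) => j; rewrite ffunE; case: (fP j).
Qed.

Lemma step_lab sg i h x : validp sg -> lab G i h = Some x ->
  exists a, [/\ step sg h = rcons h a, (forall j, a j \in avail G h j) &
    forall j x, lab G j h = Some x -> sg j x = Some (a j)].
Proof. by move=> vsg /lab_facts[? ? _ _ _]; apply: step_nonterm. Qed.

Lemma terminal_step (i : player G) (sg : sprofile G) (h : hist G) : terminal h -> step sg h = h.
Proof.
move=> /andP[_ /forallP/(_ i)/eqP t0]; case: stepP => [a /(_ i)|//].
by rewrite t0 inE.
Qed.

Lemma play_terminal (i : player G) sg : validp sg -> terminal (zeta_std sg).
Proof.
move=> vsg; have: terminal (play sg (depth G)) \/ size (play sg (depth G)) = depth G.
  elim: (depth G) => [|n [t|sz]]; [by right| |].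
    by left; rewrite playS (terminal_step i).
  have [nt|t] := g_dichot gG (play_hist sg n).
    by have [a [st _ _]] := step_nonterm vsg (play_hist sg n) nt;
       right; rewrite playS st size_rcons sz.
  by left; rewrite playS (terminal_step i).
by case=> // sz; apply: (g_finite gG (play_hist _ _)); rewrite sz.
Qed.

Lemma play_experience sg i m x a : validp sg -> (x, a) \in experience i (play sg m) ->
  sg i x = Some a /\ exists2 m', (m' < m)%N & lab G i (play sg m') = Some x.
Proof.
move=> vsg; elim: m => [//|m IHm].
have IH : (x, a) \in experience i (play sg m) -> sg i x = Some a /\
    exists2 m', (m' < m.+1)%N & lab G i (play sg m') = Some x.
  by move=> /IHm[? [m' m'm ?]]; split=> //; exists m' => //; apply: ltnW.
rewrite playS; case: stepP => [b _ ls|//].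
rewrite experience_rcons mem_cat => /orP[//|].
case lx: (lab G i (play sg m)) => [y|//]; rewrite inE => /eqP[-> ->].
by split; [apply: ls | exists m].
Qed.

Lemma experience_play sg i m n x : validp sg -> lab G i (play sg m) = Some x ->
  (m < n)%N -> (size (experience i (play sg m)) < size (experience i (play sg n)))%N
  /\ exists2 a, (x, a) \in experience i (play sg n) & sg i x = Some a.
Proof.
move=> vsg lx; elim: n => [//|n IHn]; rewrite ltnS leq_eqVlt => /orP[/eqP <-|mn].
  have [a [st _ ls]] := step_lab vsg lx.
  rewrite playS st experience_rcons lx size_cat addn1; split=> //.
  by exists (a i); [rewrite mem_cat inE eqxx orbT | apply: ls].
have [sz [a xa sa]] := IHn mn; rewrite playS; case: stepP => [b _ _|_]; last first.
  by split=> //; exists a.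
rewrite experience_rcons size_cat; split; first exact: ltn_addr.
by exists a => //; rewrite mem_cat xa.
Qed.

(** No information set is met twice along a history: the second visit would have a strictly longer
    experience than the first, against perfect recall. *)
Lemma experience_uniq i (h : hist G) x a b :
  (x, a) \in experience i h -> (x, b) \in experience i h -> a = b.
Proof.
have new (h' : hist G) c : lab G i h' = Some x -> (x, c) \in experience i h' -> False.
  move=> lx /experienceP[h1 [a' [t [hE lx' _]]]].
  have [e] := experience_cat_cons t a' lx'; rewrite -hE (g_recall gG lx lx').
  by move/(congr1 size); rewrite size_cat /= => /eqP; rewrite -[X in X == _]addn0 eqn_add2l.
elim/last_ind: h => [//|h c IHh]; rewrite experience_rcons !mem_cat.
case lx: (lab G i h) => [y|] /=; last by rewrite !orbF.
rewrite !inE => /orP[xa|/eqP[yx ->]] /orP[xb|/eqP[yx' ->]] //.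
- exact: IHh.
- by case: (new h a) => //; rewrite yx'.
- by case: (new h b) => //; rewrite yx.
Qed.

Lemma play_reaches (h : hist G) i x : lab G i h = Some x ->
  exists sg, validp sg /\ exists2 m, (m <= depth G)%N & play sg m = h.
Proof.
move=> lh; have [hh nt _ _ _] := lab_facts lh.
have sh : (size h <= depth G)%N.
  rewrite leqNgt; apply/negP => /ltnW sh.
  have /andP[_ /forallP/(_ i)/eqP t0] := g_finite gG hh sh.
  by move/forallP/(_ i): nt; rewrite t0 eqxx.
have act0 y : exists a, a \in act_at G y.
  have [h' ly] := g_used gG y; have [_ /forallP nt' _ _ <-] := lab_facts ly.
  exact/set0Pn.
have [d dP] := choice act0.
(* Each player repeats the action recorded along [h], unambiguous by [experience_uniq], and falls
   back on [d] where [h] records nothing. *)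
pose sg : sprofile G := [ffun j => [ffun y : Info G => if owner G y == j then
  Some (if [pick a in act_at G y | (y, a) \in experience j h] is Some a then a else d y)
  else None]].
have vsg : validp sg.
  apply/forallP => j; apply/forallP => y; rewrite /sg !ffunE.
  by case: ifP => ojy; rewrite ojy //; case: pickP => [a /andP[]|_] //; apply: dP.
exists sg; split=> //; exists (size h) => //.
have {sh}: forall h1 t, h = h1 ++ t -> play sg (size h1) = h1; last first.
  by move/(_ h [::]); rewrite cats0; apply.
elim/last_ind => [//|h1 a IH] t; rewrite cat_rcons => hE.
rewrite size_rcons playS (IH _ hE).
have : is_hist (rcons h1 a).
  have := @is_hist_take (size h1).+1 _ hh.
  by rewrite hE -cat_rcons take_size_cat // size_rcons.
rewrite is_hist_rcons => /andP[hh1 /forallP av].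
have nt1 : nonterm h1.
  by apply/forallP => j; apply/set0Pn; exists (a j).
have [b [-> avb ls]] := step_nonterm vsg hh1 nt1.
congr rcons; apply/ffunP => j.
case lj: (lab G j h1) => [y|].
  have [e eE] := experience_cat_cons t a lj.
  have ya : (y, a j) \in experience j h by rewrite hE eE mem_cat inE eqxx orbT.
  have [_ _ _ oj aE] := lab_facts lj.
  have := ls _ _ lj; rewrite /sg !ffunE oj eqxx; case: pickP => [c /andP[_ yc] [<-]|].
    exact: experience_uniq yc ya.
  by move/(_ (a j)); rewrite -aE av ya.
(* An unlabelled player is inactive at [h1], with at most one available action, so [a] and [b] agree
   there. *)
have := g_lab gG j h1; rewrite lj hh1 nt1 /= => /esym/negbT; rewrite -leqNgt.
by move=> /card_le1_eqP; apply.
Qed.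

Lemma lab_experience sg i m (h : hist G) x y a : validp sg ->
  lab G i (play sg m) = Some x -> lab G i h = Some x ->
  (y, a) \in experience i h ->
  sg i y = Some a /\ exists2 m', (m' < m)%N & lab G i (play sg m') = Some y.
Proof. by move=> vsg lm lh; rewrite -(g_recall gG lm lh); apply: play_experience. Qed.

(** By perfect recall the experience of [i] on the way to [x] is the same in both plays, so [sg i]
    takes the recorded actions of [sg' i] before step [m']. *)
Lemma play_join sg sg' i x m m' : validp sg -> validp sg' ->
  lab G i (play sg m) = Some x -> lab G i (play sg' m') = Some x ->
  forall sg'' : sprofile G, sg'' i = sg i -> (forall j, j != i -> sg'' j = sg' j) ->
  play sg'' m' = play sg' m'.
Proof.
move=> vsg vsg' lx lx' sg'' ei en; apply: play_agree => k j y km ly.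
have [ji|/en ->//] := eqVneq j i; subst j; rewrite ei.
have [_ [a ya ->]] := experience_play vsg' ly km.
by have [-> _] := lab_experience vsg lx lx' ya.
Qed.

End Plays.

(** * Strategies as equivalence classes: reaching information sets, and replacement *)

Section Strategies.
Set Implicit Arguments.
Unset Strict Implicit.
Variable G : gdata.
Hypothesis gG : is_game G.

Lemma SsetP i (s : strat G) : s \in Sset i ->
  exists2 sg, valid_std i sg & s = cls i sg.
Proof. by case/imsetP => sg; rewrite inE; exists sg. Qed.

Lemma mem_cls i (sg : std G) : valid_std i sg -> sg \in cls i sg.
Proof.
move=> v; rewrite inE v; apply/forallP => x; apply/implyP => _.
by rewrite !eqxx implybT.
Qed.

Lemma cls_Sset i (sg : std G) : valid_std i sg -> cls i sg \in Sset i.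
Proof. by move=> v; apply: imset_f; rewrite inE. Qed.

Lemma mem_valid i (s : strat G) sg : s \in Sset i -> sg \in s -> valid_std i sg.
Proof. by case/SsetP => ? _ ->; rewrite inE => /andP[]. Qed.

Lemma mem_equiv i (s : strat G) sg sg' x : s \in Sset i -> sg \in s -> sg' \in s ->
  owner G x = i -> allows i sg x -> sg x = sg' x.
Proof.
case/SsetP => r _ ->; rewrite !inE => /andP[_ /forallP/(_ x) e] /andP[_ /forallP/(_ x) e'] ox.
move: e e'; rewrite ox eqxx /= => /andP[/eqP <- /implyP e] /andP[_ /implyP e'] al.
by rewrite -(eqP (e al)) (eqP (e' al)).
Qed.

Lemma play_allows (sg : sprofile G) i m x : validp sg -> (m <= depth G)%N ->
  lab G i (play sg m) = Some x -> allows i (sg i) x.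
Proof.
move=> vsg mD lx; apply/existsP; exists sg; rewrite eqxx /=; apply/andP; split=> //.
by apply/passesP; exists m => //; rewrite (g_owner gG lx).
Qed.

(** Independence of representatives: equivalent strategies agree at the information sets they allow,
    and the play meets no others. *)
Lemma zetaE (P : sprof G) (sg : sprofile G) : (forall j, P j \in Sset j) ->
  (forall j, sg j \in P j) -> zeta P = zeta_std sg.
Proof.
move=> PS sgP; rewrite /zeta; case: pickP => [sg' /forallP sgP'|]; last first.
  by move=> /(_ sg)/negP; case; apply/forallP.
have vsg : validp sg by apply/forallP => j; apply: mem_valid (PS j) (sgP j).
apply: (@play_agree _ sg) => m j x mD lx.
have [_ _ _ ox _] := lab_facts gG lx.
by apply: (mem_equiv (PS j) (sgP j) (sgP' j) ox); apply: play_allows lx => //; apply: ltnW.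
Qed.

Definition rep (A : strat G) : std G := odflt [ffun=> None] [pick s in A].
Definition std_prof (i : player G) (sg : std G) (p : sprof G) : sprofile G :=
  [ffun j => if j == i then sg else rep (p j)].

Lemma std_prof_id i sg p : std_prof i sg p i = sg.
Proof. by rewrite ffunE eqxx. Qed.

Lemma std_prof_neq i sg sg' p j : j != i -> std_prof i sg p j = std_prof i sg' p j.
Proof. by rewrite !ffunE => /negbTE ->. Qed.

Lemma SminusP i (p : sprof G) j : p \in Sminus i -> j != i -> p j \in Sset j.
Proof. by rewrite inE => /andP[_ /forallP/(_ j)/implyP]. Qed.

Lemma join_Sset i s (p : sprof G) j : s \in Sset i -> p \in Sminus i -> join i s p j \in Sset j.
Proof.
by move=> sS pS; rewrite ffunE; have [->|ji] := eqVneq; last exact: SminusP pS ji.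
Qed.

Lemma std_prof_mem i s sg (p : sprof G) j : s \in Sset i -> sg \in s -> p \in Sminus i ->
  std_prof i sg p j \in join i s p j.
Proof.
move=> sS sgs pS; rewrite !ffunE; have [//|ji] := eqVneq.
have [r vr ->] := SsetP (SminusP pS ji).
by rewrite /rep; case: pickP => [//|/(_ r)]; rewrite mem_cls.
Qed.

Lemma std_prof_valid i s sg (p : sprof G) : s \in Sset i -> sg \in s -> p \in Sminus i ->
  validp (std_prof i sg p).
Proof.
move=> sS sgs pS; apply/forallP => j.
exact: mem_valid (join_Sset j sS pS) (std_prof_mem j sS sgs pS).
Qed.

Lemma zeta_std_prof i s sg (p : sprof G) : s \in Sset i -> sg \in s -> p \in Sminus i ->
  zeta (join i s p) = zeta_std (std_prof i sg p).
Proof.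
by move=> sS sgs pS; apply: zetaE => j; [apply: join_Sset | apply: std_prof_mem].
Qed.

Lemma zeta_terminal i s (p : sprof G) : s \in Sset i -> p \in Sminus i ->
  terminal (zeta (join i s p)).
Proof.
move=> sS pS; have [sg vsg sE] := SsetP sS.
have sgs : sg \in s by rewrite sE mem_cls.
by rewrite (zeta_std_prof sS sgs pS); apply: (play_terminal gG i); apply: std_prof_valid sgs pS.
Qed.

Lemma passes_std_prof i s sg (p : sprof G) x : owner G x = i ->
  s \in Sset i -> sg \in s -> p \in Sminus i ->
  reflect (exists2 m, (m <= depth G)%N & lab G i (play (std_prof i sg p) m) = Some x)
    (passes (zeta (join i s p)) x).
Proof. by move=> <- sS sgs pS; rewrite (zeta_std_prof sS sgs pS); apply: passesP. Qed.

Lemma Si_Sset i x (s : strat G) : s \in Si i x -> s \in Sset i.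
Proof. by rewrite inE => /andP[]. Qed.

Lemma Smi_Sminus i x (p : sprof G) : p \in Smi i x -> p \in Sminus i.
Proof. by rewrite inE => /andP[]. Qed.

Lemma passes_Si i x s (p : sprof G) : s \in Sset i -> p \in Sminus i ->
  passes (zeta (join i s p)) x -> s \in Si i x.
Proof. by move=> sS pS ps; rewrite inE sS; apply/existsP; exists p; rewrite pS. Qed.

Lemma passes_Smi i x s (p : sprof G) : s \in Sset i -> p \in Sminus i ->
  passes (zeta (join i s p)) x -> p \in Smi i x.
Proof. by move=> sS pS ps; rewrite inE pS; apply/existsP; exists s; rewrite sS. Qed.

(** Perfect recall makes reaching [x] a product condition: one play supplies the part of [i],
    another that of the opponents, and [play_join] merges them. *)
Lemma Si_Smi_passes i x s (p : sprof G) : owner G x = i -> s \in Si i x -> p \in Smi i x ->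
  passes (zeta (join i s p)) x.
Proof.
move=> ox sx px; have sS := Si_Sset sx; have pS := Smi_Sminus px.
have [sg vsg sE] := SsetP sS; have sgs : sg \in s by rewrite sE mem_cls.
move: sx; rewrite inE => /andP[_ /existsP[p' /andP[p'S]]].
case/(passes_std_prof ox sS sgs p'S) => m mD lx.
move: px; rewrite inE => /andP[_ /existsP[s' /andP[s'S]]].
have [sg' vsg' s'E] := SsetP s'S; have sgs' : sg' \in s' by rewrite s'E mem_cls.
case/(passes_std_prof ox s'S sgs' pS) => m' mD' lx'.
apply/(passes_std_prof ox sS sgs pS); exists m' => //.
have v := std_prof_valid sS sgs p'S; have v' := std_prof_valid s'S sgs' pS.
by rewrite (play_join gG v v' lx lx') ?std_prof_id// => j ji; apply: std_prof_neq.
Qed.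

Lemma Smi_neq0 x : Smi (owner G x) x != set0.
Proof.
have [h lh] := g_used gG x; set i := owner G x.
have [sg [vsg [m mD mE]]] := play_reaches gG lh.
have vj j : valid_std j (sg j) by move/forallP: vsg.
pose p : sprof G := [ffun j => if j == i then set0 else cls j (sg j)].
have pS : p \in Sminus i.
  rewrite inE ffunE !eqxx; apply/forallP => j; apply/implyP => ji.
  by rewrite ffunE (negbTE ji) cls_Sset.
have sS := cls_Sset (vj i); apply/set0Pn; exists p.
apply: (passes_Smi sS) => //; rewrite (@zetaE _ sg); last 2 first.
- by move=> j; apply: join_Sset.
- by move=> j; rewrite !ffunE; have [->|ji] := eqVneq; rewrite ?(negbTE ji) mem_cls.
by apply/passesP; exists m; rewrite // mE.
Qed.

(** By perfect recall the owner's experience there does not depend on the history chosen. *)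
Definition used_hist x : hist G := projT1 (cid (g_used gG x)).

Lemma lab_used_hist x : lab G (owner G x) (used_hist x) = Some x.
Proof. exact: projT2 (cid (g_used gG x)). Qed.

(* An injective linear extension of the precedence order on the information
   sets of a player. *)
Definition key x :=
  (size (experience (owner G x) (used_hist x)) * #|Info G| + enum_rank x)%N.

Lemma key_inj : injective key.
Proof.
move=> x y /(congr1 (modn^~ #|Info G|)); rewrite !modnMDl !modn_small//.
by move/ord_inj/enum_rank_inj.
Qed.

Lemma key_le x y : (key x <= key y)%N ->
  (size (experience (owner G x) (used_hist x))
   <= size (experience (owner G y) (used_hist y)))%N.
Proof.
move=> /(leq_div2r #|Info G|).
have I0 : (0 < #|Info G|)%N by apply/card_gt0P; exists x.
by rewrite !divnMDl// !divn_small// !addn0.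
Qed.

(** Experience grows strictly along the play of [s] and [p], so [y] is met first unless it equals
    [x]. That visit is recorded in the experience at [x], hence occurs on every play reaching
    [x]. *)
Lemma precedes_sub i x y s (p : sprof G) : owner G x = i -> owner G y = i ->
  s \in Si i x -> s \in Si i y -> p \in Smi i x -> p \in Smi i y ->
  (key y <= key x)%N -> {subset Si i x <= Si i y} /\ {subset Smi i x <= Smi i y}.
Proof.
move=> ox oy sx sy px py /key_le; rewrite ox oy => d.
have sS := Si_Sset sx; have pS := Smi_Sminus px.
have [sg vsg sE] := SsetP sS; have sgs : sg \in s by rewrite sE mem_cls.
have vp := std_prof_valid sS sgs pS.
have /(passes_std_prof ox sS sgs pS)[m mD lm] := Si_Smi_passes ox sx px.
have /(passes_std_prof oy sS sgs pS)[n nD ln] := Si_Smi_passes oy sy py.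
have lx := lab_used_hist x; have ly := lab_used_hist y; rewrite ox in lx; rewrite oy in ly.
have : (n <= m)%N.
  rewrite leqNgt; apply/negP => mn; have [] := experience_play gG vp lm mn.
  by rewrite (g_recall gG lm lx) (g_recall gG ln ly) ltnNge d.
rewrite leq_eqVlt => /orP[/eqP nm|nm].
  by have -> : y = x; [apply: Some_inj; rewrite -ln nm lm | split].
have [_ [a ya _]] := experience_play gG vp ln nm.
suff sub s' p' : s' \in Sset i -> p' \in Sminus i ->
    passes (zeta (join i s' p')) x -> passes (zeta (join i s' p')) y.
  split=> [s' sx'|p' px'].
    have sS' := Si_Sset sx'; apply: (passes_Si sS' pS); apply: sub => //.
    exact: Si_Smi_passes.
  have pS' := Smi_Sminus px'; apply: (passes_Smi sS pS'); apply: sub => //.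
  exact: Si_Smi_passes.
move=> sS' pS'; have [sg' vsg' sE'] := SsetP sS'.
have sgs' : sg' \in s' by rewrite sE' mem_cls.
case/(passes_std_prof ox sS' sgs' pS') => m' mD' lm'.
have [_ [n' nm' ln']] := lab_experience gG (std_prof_valid sS' sgs' pS') lm' lm ya.
by apply/(passes_std_prof oy sS' sgs' pS'); exists n' => //; apply: leq_trans mD'; apply: ltnW.
Qed.

(* Follow [t] from the information set [x] on and [s] elsewhere. *)
Lemma replacement i x s t : owner G x = i -> s \in Si i x -> t \in Si i x ->
  exists2 r, r \in Sset i & forall p : sprof G, p \in Sminus i ->
    zeta (join i r p) = zeta (join i (if p \in Smi i x then t else s) p).
Proof.
move=> ox sx tx; have sS := Si_Sset sx; have tS := Si_Sset tx.
have [sg vsg sE] := SsetP sS; have sgs : sg \in s by rewrite sE mem_cls.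
have [tg vtg tE] := SsetP tS; have tgt : tg \in t by rewrite tE mem_cls.
(* The information sets from [x] on are recognized by the visit to [x] that their experience
   records. *)
pose after y := (y == x) || [exists a, (x, a) \in experience i (used_hist y)].
pose rg : std G := [ffun y => if after y then tg y else sg y].
have vrg : valid_std i rg.
  apply/forallP => y; rewrite ffunE.
  by case: (after y); [move: vtg => /forallP/(_ y) | move: vsg => /forallP/(_ y)].
have rS := cls_Sset vrg; have rgr := mem_cls vrg.
exists (cls i rg) => // p pS; rewrite (zeta_std_prof rS rgr pS).
case: ifPn => px.
  rewrite (zeta_std_prof tS tgt pS); apply: play_agree => k j y kD ly.
  have [ji|ji] := eqVneq j i; last by rewrite (std_prof_neq tg rg p ji).
  subst j; rewrite !std_prof_id ffunE; case: ifPn => //.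
  rewrite negb_or => /andP[yx /existsPn na].
  have /(passes_std_prof ox tS tgt pS)[m mD lm] := Si_Smi_passes ox tx px.
  have /(passes_std_prof ox sS sgs pS)[n nD ln] := Si_Smi_passes ox sx px.
  have vt := std_prof_valid tS tgt pS; have vs := std_prof_valid sS sgs pS.
  (* Past [x] the play meets only sets in [after]; before [x], perfect recall makes [s] prescribe
     the recorded action of [t]. *)
  have [ltmk|km|km_eq] := ltngtP m k.
  - have [_ [a xa _]] := experience_play gG vt lm ltmk.
    have lu := lab_used_hist y; rewrite (g_owner gG ly) in lu.
    by move: (na a); rewrite (g_recall gG lu ly) xa.
  - have [_ [a ya]] := experience_play gG vt ly km; rewrite std_prof_id => ->.
    by have [] := lab_experience gG vs ln lm ya; rewrite std_prof_id.
  - by case/eqP: yx; apply: Some_inj; rewrite -ly -km_eq lm.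
rewrite (zeta_std_prof sS sgs pS); apply: play_agree => k j y kD ly.
have [ji|ji] := eqVneq j i; last by rewrite (std_prof_neq sg rg p ji).
subst j; rewrite !std_prof_id ffunE; case: ifPn => // aft.
(* Meeting a set in [after], the play of [s] against [p] would have visited [x], putting [p] in
   [Smi i x]. *)
have vs := std_prof_valid sS sgs pS; case/negP: px.
apply: (passes_Smi sS pS); apply/(passes_std_prof ox sS sgs pS).
have [<-|yx] := eqVneq y x; first by exists k => //; apply: ltnW.
move: aft; rewrite /after (negbTE yx) => /existsP[a xa].
have lu := lab_used_hist y; rewrite (g_owner gG ly) in lu.
have [_ [m std_prof lm]] := lab_experience gG vs ly lu xa.
by exists m => //; apply: ltnW; apply: ltn_trans std_prof kD.
Qed.

End Strategies.

Local Open Scope ring_scope.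

(** * Lexicographic maximization over a finite set *)

Section LexMax.
Set Implicit Arguments.
Unset Strict Implicit.
Variables (Rl : realType) (T : finType).

Fixpoint lexle (fs : seq (T -> Rl)) (r s : T) : Prop :=
  if fs is f :: fs' then f r < f s \/ f r = f s /\ lexle fs' r s else True.

Lemma lexmax_exists fs (A : {set T}) : A != set0 ->
  exists2 s, s \in A & forall r, r \in A -> lexle fs r s.
Proof.
elim: fs A => [|f fs IH] A A0; first by have [s sA] := set0Pn _ A0; exists s.
have [a aA] := set0Pn _ A0.
have [m mA' mmax] := arg_maxP f aA; have mA : m \in A by [].
have [|s] := IH [set r in A | f r == f m].
  by apply/set0Pn; exists m; rewrite inE mA eqxx.
rewrite inE => /andP[sA /eqP sm] sP; exists s => // r rA /=.
have : f r <= f m by apply: mmax.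
rewrite le_eqVlt -sm => /orP[/eqP rm|]; last by left.
by right; split=> //; apply: sP; rewrite inE rA rm sm eqxx.
Qed.
End LexMax.

(** * Lists of weights as conditional probability systems *)

Section Beliefs.
Set Implicit Arguments.
Unset Strict Implicit.
Variables (G : gdata) (Rl : realType).
Implicit Types (nu : {ffun sprof G -> Rl}) (L M : seq {ffun sprof G -> Rl}).
Implicit Types (E : {set sprof G}) (R : rstr G) (r s t : strat G).

Definition mass nu E : Rl := \sum_(p in E) nu p.

Fixpoint sel (L : seq {ffun sprof G -> Rl}) E : {ffun sprof G -> Rl} :=
  if L is nu :: L' then if mass nu E != 0 then nu else sel L' E else [ffun=> 0].

Definition covers (L : seq {ffun sprof G -> Rl}) E :=
  has (fun nu => mass nu E != 0) L.

Definition cps_of L E (p : sprof G) : Rl :=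
  if p \in E then sel L E p / mass (sel L E) E else 0.

Definition supported nu E := forall p, nu p != 0 -> p \in E.

Lemma sel_cat L1 L2 E :
  sel (L1 ++ L2) E = if covers L1 E then sel L1 E else sel L2 E.
Proof. by elim: L1 => //= nu L1 ->; case: ifP. Qed.

Lemma sel_mem L E : covers L E -> sel L E \in L.
Proof.
elim: L => //= nu L IH; case: ifP => /= [_|_ /IH]; first by rewrite mem_head.
by rewrite inE orbC => ->.
Qed.

Lemma mass_sel L E : covers L E -> mass (sel L E) E != 0.
Proof. by elim: L => //= nu L IH; case: ifP. Qed.

Lemma mass_ge0 nu E : (forall p, 0 <= nu p) -> 0 <= mass nu E.
Proof. by move=> nu0; apply: sumr_ge0 => p _. Qed.

Lemma mass_eq0 nu E : (forall p, 0 <= nu p) -> mass nu E = 0 ->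
  forall p, p \in E -> nu p = 0.
Proof. by move=> nu0 m0; apply: (psumr_eq0P _ m0) => p _. Qed.

Lemma mass_neq0 nu E p : (forall p, 0 <= nu p) -> p \in E -> nu p != 0 -> mass nu E != 0.
Proof. by move=> nu0 pE; apply: contraNneq => /(mass_eq0 nu0) ->. Qed.

Lemma mass_neq0_ex nu E : mass nu E != 0 -> exists2 p, p \in E & nu p != 0.
Proof.
apply: contraNP => no; apply/eqP/big1 => p pE.
by apply/eqP; apply: contra_notT no => nup; exists p.
Qed.

Lemma mass_sub nu E E' : (forall p, 0 <= nu p) -> E' \subset E -> mass nu E = 0 -> mass nu E' = 0.
Proof.
move=> nu0 /subsetP sub /(mass_eq0 nu0) z; apply: big1 => p /sub; exact: z.
Qed.

(** Weights skipped at [E] vanish on [E], hence on the smaller [E'], so the weight selected at [E]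
    is also the first to charge [E']. *)
Lemma sel_sub L E E' : (forall nu, nu \in L -> forall p, 0 <= nu p) ->
  E' \subset E -> mass (sel L E) E' != 0 -> sel L E' = sel L E.
Proof.
move=> + sub; elim: L => //= nu L IH L0.
have IH' := IH (fun nu' m => L0 nu' (mem_behead (s := nu :: L) m)).
case: ifPn => [m m'|]; first by rewrite m'.
by rewrite negbK => /eqP/(mass_sub (L0 _ (mem_head _ _)) sub) -> /IH' ->; rewrite eqxx.
Qed.

Lemma mu_of_cps L E A :
  mu_of (cps_of L) E A = mass (sel L E) (A :&: E) / mass (sel L E) E.
Proof.
rewrite /mu_of /cps_of -big_mkcondr /= /mass mulr_suml.
by apply: eq_bigl => p; rewrite inE.
Qed.

(** For the chain rule, either the weight selected at [E] is null on [E'] and both sides vanish, or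
    [E'] selects the same weight and its mass cancels. *)
Lemma cps_ofP i L : (forall nu, nu \in L -> forall p, 0 <= nu p) ->
  (forall E, E \in Hsets i -> covers L E) -> is_cps i (cps_of L).
Proof.
move=> L0 cov E EH; have cE := cov _ EH; have mE := mass_sel cE.
have sub : E \subset Sminus i.
  by case/imsetP: EH => x _ ->; apply/subsetP => p /Smi_Sminus.
have s0 := L0 _ (sel_mem cE); split=> [p _|||E' A EH' E'E AE'].
- by rewrite /cps_of; case: ifP => // _; rewrite divr_ge0 ?mass_ge0.
- by rewrite mu_of_cps (setIidPr sub) divff.
- by rewrite mu_of_cps setIid divff.
rewrite !mu_of_cps (setIidPl AE') (setIidPl E'E) (setIidPl (subset_trans AE' E'E)).
have [z|nz] := eqVneq (mass (sel L E) E') 0.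
  by rewrite z (mass_sub s0 AE' z) !mul0r mulr0.
by rewrite (sel_sub L0 E'E nz) mulrA divfK.
Qed.

Variables (u : player G -> hist G -> Rl) (i : player G).

(** Left unnormalized: dividing by a positive mass would not affect comparisons between
    strategies. *)
Definition payoff nu E s : Rl := \sum_(p in E) nu p * u i (zeta (join i s p)).

Lemma EU_cps R L x s : owner G x = i ->
  supported (sel L (Smi i x)) (Rminus i R) ->
  EU u i R (cps_of L) x s = payoff (sel L (Smi i x)) (Smi i x) s / mass (sel L (Smi i x)) (Smi i x).
Proof.
move=> ox sup; rewrite /EU /payoff mulr_suml.
rewrite big_mkcond [RHS]big_mkcond; apply: eq_bigr => p _; rewrite /cps_of.
case: (boolP (p \in Smi i x)) => pS; last by rewrite mulr0 if_same.
case: ifPn => [_|pR]; first by rewrite mulrCA mulrA.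
by have [->|/sup] := eqVneq (sel L (Smi i x) p) 0; rewrite ?mul0r// (negbTE pR).
Qed.

Lemma SRop_cps R L s : s \in R i -> (forall nu, nu \in L -> forall p, 0 <= nu p) ->
  (forall E, E \in Hsets i -> covers L E) ->
  (forall x, owner G x = i -> Rmi i R x != set0 -> supported (sel L (Smi i x)) (Rminus i R)) ->
  (forall x, owner G x = i -> s \in Si i x -> Rmi i R x != set0 -> forall t, t \in Ri i R x ->
     payoff (sel L (Smi i x)) (Smi i x) t <= payoff (sel L (Smi i x)) (Smi i x) s) ->
  s \in SRop u R i.
Proof.
move=> sR L0 cov sup best; rewrite inE sR; apply/asboolP; exists (cps_of L).
split; first split; first exact: cps_ofP.
  move=> x ox /andP[_ ne]; have cE : covers L (Smi i x).
    by apply: cov; apply: imset_f; rewrite inE ox.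
  rewrite mu_of_cps -setIA setIid [X in X / _](_ : _ = mass (sel L (Smi i x)) (Smi i x)).
    by rewrite divff// mass_sel.
  rewrite /mass big_mkcond [RHS]big_mkcond; apply: eq_bigr => p _; rewrite inE.
  case: (boolP (p \in Smi i x)) => [_|_]; rewrite ?andbF// andbT.
  case: ifPn => // pR; apply/esym/eqP; apply: contraNT pR; exact: sup.
move=> x ox sx /andP[ne1 ne] t tR; have supx := sup x ox ne.
rewrite !EU_cps// ler_pM2r ?best// invr_gt0.
have cE : covers L (Smi i x) by apply: cov; apply: imset_f; rewrite inE ox.
by rewrite lt_def mass_sel// mass_ge0//; apply/L0/sel_mem.
Qed.

(** Since [r] departs from [s] only on [E], optimality at the larger event [D] passes to [E]. *)
Lemma payoff_replace nu (D E : {set sprof G}) r s t : D \subset Sminus i -> E \subset D ->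
  (forall p, p \in Sminus i ->
     zeta (join i r p) = zeta (join i (if p \in E then t else s) p)) ->
  payoff nu D r - payoff nu D s = payoff nu E t - payoff nu E s.
Proof.
move=> /subsetP DS ED rE; rewrite /payoff -!sumrB.
rewrite [LHS](big_setID E) /= [X in _ + X]big1 ?addr0 => [|p].
  rewrite (setIidPr ED); apply: eq_bigr => p pE; rewrite rE ?pE//.
  by apply/DS/(subsetP ED).
by rewrite inE => /andP[/negbTE pE /DS pS]; rewrite rE// pE subrr.
Qed.

(** Weights before the selected one vanish on [E], where alone [r] and [s] can differ; they tie, and
    the lexicographic comparison moves on to the selected weight. *)
Lemma lexle_sel M E r s : (forall nu, nu \in M -> forall p, 0 <= nu p) ->
  lexle [seq payoff nu (Sminus i) | nu <- M] r s ->
  (forall p, p \in Sminus i -> p \notin E -> zeta (join i r p) = zeta (join i s p)) ->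
  payoff (sel M E) (Sminus i) r <= payoff (sel M E) (Sminus i) s.
Proof.
move=> + + agr; elim: M => [_ _|nu M IH M0] /=.
  by rewrite /payoff !big1// => p _; rewrite ffunE mul0r.
have nu0 := M0 _ (mem_head _ _); case: ifPn => [_ [/ltW//|[->]//]|].
rewrite negbK => /eqP/(mass_eq0 nu0) z.
suff -> : payoff nu (Sminus i) r = payoff nu (Sminus i) s.
  rewrite ltxx => -[//|[_ /IH]]; apply => nu' m; apply: M0; exact: (mem_behead (s := nu :: M)).
apply: eq_bigr => p pS; have [/z ->|pE] := boolP (p \in E); first by rewrite !mul0r.
by rewrite agr.
Qed.

End Beliefs.

(** * The risk averse ordinal utility *)

Section Utility.
Set Implicit Arguments.
Unset Strict Implicit.
Variables (G : gdata) (Rl : realType).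
Hypothesis gG : is_game G.

(** A longer history would continue past its prefix of length [depth G], which is terminal. The
    bound lets [rank] count terminal histories inside a finite type. *)
Lemma terminal_size (i : player G) (z : hist G) : terminal z -> (size z <= depth G)%N.
Proof.
move=> tz; rewrite leqNgt; apply/negP => sz; have /andP[hz _] := tz.
have st : size (take (depth G) z) = depth G by rewrite size_take sz.
have t : terminal (take (depth G) z).
  by apply: (g_finite gG (is_hist_take _ hz)); rewrite st.
have := is_hist_take (depth G).+1 hz.
case E : (drop (depth G) z) => [|a r].
  by move/(congr1 size): E; rewrite size_drop /=; lia.
rewrite -[z](cat_take_drop (depth G)) E -cat_rcons take_size_cat ?size_rcons ?st//.
rewrite is_hist_rcons => /andP[_ /forallP/(_ i)].
by case/andP: t => _ /forallP/(_ i)/eqP ->; rewrite inE.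
Qed.

Definition rank (i : player G) (z : hist G) : nat :=
  #|[set b : (depth G).-bseq (prof G) | terminal b && pref G i z b]|.

Lemma rankP i z z' : terminal z -> terminal z' -> (rank i z' <= rank i z)%N = pref G i z z'.
Proof.
move=> tz tz'; have tr := g_trans gG (i := i); apply/idP/idP => [|zz'].
  apply: contraTT => nzz'; rewrite -ltnNge; apply: proper_card.
  have z'z : pref G i z' z by have := g_complete gG i tz tz'; rewrite (negbTE nzz').
  apply/properP; split.
    apply/subsetP => b; rewrite !inE => /andP[tb zb].
    by rewrite tb (tr _ _ _ tz' tz tb z'z zb).
  exists (Bseq (terminal_size i tz')); rewrite inE /= tz' ?(negbTE nzz')//=.
  by have := g_complete gG i tz' tz'; rewrite orbb.
apply: subset_leq_card; apply/subsetP => b; rewrite !inE => /andP[tb zb].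
by rewrite tb (tr _ _ _ tz tz' tb zz' zb).
Qed.

(** [base - 1] exceeds the number of profiles, so one loss of that size outweighs a gain of 1 at
    every other profile. *)
Definition base : Rl := (#|sprof G| + 2)%:R.

Lemma base_gt1 : 1 < base.
Proof. by rewrite /base ltr1n; lia. Qed.

(* Extremely risk averse: dropping one rank outweighs, [#|sprof G|] times over,
   any rise from the original rank. *)
Definition util (i : player G) (z : hist G) : Rl := - base ^- rank i z.

Lemma base_gt0 : 0 < base.
Proof. exact: lt_trans ltr01 base_gt1. Qed.

Lemma ler_util i z z' : (util i z' <= util i z) = (rank i z' <= rank i z)%N.
Proof.
rewrite /util lerN2 lef_pV2 ?posrE ?exprn_gt0 ?base_gt0//.
by rewrite ler_eXn2l// base_gt1.
Qed.

Lemma util_ordrep i : is_ordrep i (util i).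
Proof. by move=> z z' tz tz'; rewrite ler_util rankP. Qed.

(** The weight scales the payoff of [s] to [-1] at every profile of [Q]. Deviating to [t] then adds
    1 minus a quotient of powers of [base]: at most 1, and at most [1 - base] where [t] loses
    rank. *)
Lemma boergers i (P : {set strat G}) (Q : {set sprof G}) s :
  {subset P <= Sset i} -> {subset Q <= Sminus i} -> s \in P ->
  (forall t, t \in P -> ~~ wdom i Q s t) ->
  exists nu : {ffun sprof G -> Rl}, [/\ forall p, 0 <= nu p, supported nu Q,
    forall p, p \in Q -> nu p != 0 &
    forall t, t \in P -> payoff util i nu Q t <= payoff util i nu Q s].
Proof.
move=> PS QS sP nd.
pose nu : {ffun sprof G -> Rl} :=
  [ffun p => if p \in Q then base ^+ rank i (zeta (join i s p)) else 0].
have b0 := base_gt0; have b1 := base_gt1.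
have bn n : base ^+ n != 0 by rewrite expf_neq0// gt_eqF.
exists nu; split=> [p|p|p pQ|t tP]; rewrite ?ffunE ?pQ //.
- by case: ifP => // _; rewrite exprn_ge0// ltW.
- by case: ifP => //; rewrite eqxx.
have tZ p : p \in Q -> terminal (zeta (join i t p)).
  by move=> pQ; apply: zeta_terminal (PS _ tP) (QS _ pQ).
have sZ p : p \in Q -> terminal (zeta (join i s p)).
  by move=> pQ; apply: zeta_terminal (PS _ sP) (QS _ pQ).
pose r p := rank i (zeta (join i s p)); pose r' p := rank i (zeta (join i t p)).
rewrite -subr_le0 /payoff -sumrB.
have -> : \sum_(p in Q) (nu p * util i (zeta (join i t p)) -
    nu p * util i (zeta (join i s p))) = \sum_(p in Q) (1 - base ^+ r p / base ^+ r' p).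
  apply: eq_bigr => p pQ; rewrite ffunE pQ /util !mulrN opprK -/(r p) -/(r' p).
  by rewrite divff// addrC.
have le1 p : 1 - base ^+ r p / base ^+ r' p <= 1.
  by rewrite gerBl divr_ge0// exprn_ge0// ltW.
have [dom|/forall_inPn[p pQ]] := boolP [forall p in Q,
    pref G i (zeta (join i t p)) (zeta (join i s p))].
  (* Nowhere worse and yet not dominating, [t] is nowhere better: all ranks agree. *)
  move: (nd _ tP); rewrite /wdom dom /= => /exists_inPn eqv.
  rewrite big1// => p pQ; move: (eqv p pQ); rewrite /spref (forall_inP dom)//= negbK.
  rewrite -rankP ?tZ ?sZ// => le1'.
  move: (forall_inP dom _ pQ); rewrite -rankP ?tZ ?sZ// => le2.
  have -> : r p = r' p by apply/eqP; rewrite eqn_leq le1' le2.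
  by rewrite divff// subrr.
rewrite -rankP ?tZ ?sZ// -ltnNge -/(r p) -/(r' p) => lt.
rewrite (bigD1 p pQ) /=.
have lep : 1 - base ^+ r p / base ^+ r' p <= 1 - base.
  by rewrite lerB// ler_pdivlMr ?exprn_gt0// -exprS ler_eXn2l.
have sumle : \sum_(q in Q | q != p) (1 - base ^+ r q / base ^+ r' q) <= #|sprof G|%:R.
  apply: le_trans (_ : \sum_(q in Q | q != p) 1 <= _); first exact: ler_sum.
  by rewrite sumr_const ler_nat max_card.
apply: le_trans (lerD lep sumle) _.
by rewrite /base natrD opprD addrA addrAC subrK subr_le0 ler1n.
Qed.

End Utility.

(** * The rounds of Strong Rationalizability and the weights that complete a list *)

Section Main.
Set Implicit Arguments.
Unset Strict Implicit.
Variables (G : gdata) (Rl : realType).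
Hypothesis gG : is_game G.
Let u : player G -> hist G -> Rl := @util G Rl.
Let SR n : rstr G := SRiter u n.
Implicit Types (nu : {ffun sprof G -> Rl}) (L M : seq {ffun sprof G -> Rl}).

Lemma SRiterS n i : {subset SR n.+1 i <= SR n i}.
Proof. by move=> s; rewrite inE => /andP[]. Qed.

Lemma SRiter_le m n i : (m <= n)%N -> {subset SR n i <= SR m i}.
Proof.
elim: n => [|n IH]; first by rewrite leqn0 => /eqP->.
by rewrite leq_eqVlt => /orP[/eqP->//|mn] s /SRiterS; apply: IH.
Qed.

Lemma Rminus_le m n i : (m <= n)%N -> {subset Rminus i (SR n) <= Rminus i (SR m)}.
Proof.
move=> mn p; rewrite !inE => /andP[-> /forallP all] /=; apply/forallP => j.
by apply/implyP => /(implyP (all j)); apply: SRiter_le.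
Qed.

Lemma Rminus_Sminus n i : {subset Rminus i (SR n) <= Sminus i}.
Proof. exact: (@Rminus_le 0). Qed.

Definition indic (A : {set sprof G}) : {ffun sprof G -> Rl} := [ffun p => (p \in A)%:R].

Lemma indic_ge0 A p : 0 <= indic A p.
Proof. by rewrite ffunE ler0n. Qed.

Lemma indic_supp A : supported (indic A) A.
Proof. by move=> p; rewrite ffunE; case: (p \in A) => //; rewrite eqxx. Qed.

Lemma mass_indic A E : A :&: E != set0 -> mass (indic A) E != 0.
Proof.
case/set0Pn => p /setIP[pA pE]; apply: (mass_neq0 (p := p)) => //.
  exact: indic_ge0.
by rewrite ffunE pA oner_eq0.
Qed.

(** Appended to a list so that every conditioning event is charged, the latest round compatible with
    the event being tried first. *)
Fixpoint tail i n : seq {ffun sprof G -> Rl} :=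
  indic (Rminus i (SR n)) :: if n is m.+1 then tail i m else [::].

Lemma tail_ge0 i n nu : nu \in tail i n -> forall p, 0 <= nu p.
Proof.
elim: n => [|n IH] /=; first by rewrite inE => /eqP->; apply: indic_ge0.
by rewrite inE => /orP[/eqP->|/IH//]; apply: indic_ge0.
Qed.

(** The weight selected at [E] is the indicator of round [k] or of a later, hence smaller, round. *)
Lemma tail_covers i n k E : (k <= n)%N -> Rminus i (SR k) :&: E != set0 ->
  covers (tail i n) E /\ supported (sel (tail i n) E) (Rminus i (SR k)).
Proof.
move=> + ne; elim: n => [|n IH].
  rewrite leqn0 => /eqP k0; subst k.
  by rewrite /= mass_indic//; split=> //; apply: indic_supp.
have tE : tail i n.+1 = indic (Rminus i (SR n.+1)) :: tail i n by [].
rewrite tE leq_eqVlt => /orP[/eqP kn|kn].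
  subst k; move: (Rminus i (SR n.+1)) ne => B ne.
  by rewrite /= mass_indic//; split=> //; apply: indic_supp.
have [cov sup] := IH kn; have sub := @Rminus_le k n.+1 i (leqW kn).
move: (Rminus i (SR n.+1)) sub => B sub /=; rewrite cov orbT; split=> //.
by case: ifP => // _ p /indic_supp /sub.
Qed.

Lemma Hsets_covers i n E : E \in Hsets i -> covers (tail i n) E.
Proof.
case/imsetP => x; rewrite inE => /eqP ox ->.
apply: (proj1 (@tail_covers i n 0 _ _ _)) => //.
have := Smi_neq0 gG x; rewrite ox => /set0Pn[p px]; apply/set0Pn; exists p.
by rewrite inE px andbT; apply: Smi_Sminus px.
Qed.

(** * A strategy surviving [Uop] is justified by a single conditional system *)

Section Player.
Variables (i : player G) (n : nat).

Let nonneg L := forall nu, nu \in L -> forall p, 0 <= nu p.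
Let concentrated L := forall nu, nu \in L -> supported nu (Rminus i (SR n)).
Let best L s x := forall t, t \in Si i x ->
  payoff u i (sel L (Smi i x)) (Smi i x) t <= payoff u i (sel L (Smi i x)) (Smi i x) s.

Lemma sel_tail_supp L k x : concentrated L -> (k <= n)%N ->
  Rmi i (SR k) x != set0 -> supported (sel (L ++ tail i n) (Smi i x)) (Rminus i (SR k)).
Proof.
move=> Lc kn ne; rewrite sel_cat; case: ifP => [cov|_].
  by move=> p /(Lc _ (sel_mem cov)); apply: Rminus_le.
exact: (proj2 (tail_covers kn ne)).
Qed.

Lemma nonneg_tail L : nonneg L -> nonneg (L ++ tail i n).
Proof. by move=> L0 nu; rewrite mem_cat => /orP[/L0//|/tail_ge0]. Qed.

Lemma Hsets_covers_cat L E : E \in Hsets i -> covers (L ++ tail i n) E.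
Proof. by move=> EH; rewrite /covers has_cat orbC [X in X || _](Hsets_covers n EH). Qed.

(** One list serves all rounds up to [n]: its completion is concentrated on [SR k] wherever that is
    possible, and optimality within [Si i x] covers the competitors of every round. *)
Lemma best_SRiter L s : nonneg L -> concentrated L -> s \in Sset i ->
  (forall x, owner G x = i -> s \in Si i x -> best (L ++ tail i n) s x) ->
  s \in SR n i.
Proof.
move=> L0 Lc sS sb; suff: forall k, (k <= n)%N -> s \in SR k i by apply.
elim=> [//|k IH] kn; apply: (SRop_cps (L := L ++ tail i n)).
- exact/IH/ltnW.
- exact: nonneg_tail.
- by move=> E; apply: Hsets_covers_cat.
- by move=> x ox ne; apply: sel_tail_supp => //; apply: ltnW.
- by move=> x ox sx _ t; rewrite inE => /andP[_ tx]; apply: sb.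
Qed.

Variable s : strat G.
Hypothesis sU : s \in Uop (SR n) i.

Let sR : s \in SR n i. Proof. by move: sU; rewrite inE => /andP[]. Qed.
Let sS : s \in Sset i. Proof. exact: SRiter_le (leq0n n) _ sR. Qed.

(** Invariant of the recursion along [key]. Charging is required only below [N], optimality of [s]
    at every reached set that [L] charges. *)
Let justifies L N := [/\ nonneg L, concentrated L,
  forall x, owner G x = i -> s \in Si i x -> (key gG x < N)%N ->
    Rmi i (SR n) x != set0 -> covers L (Smi i x) &
  forall x, owner G x = i -> s \in Si i x -> covers L (Smi i x) -> best L s x].

Lemma Smi_sub x : Smi i x \subset Sminus i.
Proof. by apply/subsetP => p; apply: Smi_Sminus. Qed.

(** Failure of B-dominance provides a set [Q], and the weight given by [boergers] vanishes outside
    it. *)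
Lemma undominated_best h : owner G h = i -> s \in Si i h -> Rmi i (SR n) h != set0 ->
  exists nu, [/\ forall p, 0 <= nu p, supported nu (Rmi i (SR n) h), mass nu (Smi i h) != 0 &
    forall t, t \in Ri i (SR n) h -> payoff u i nu (Smi i h) t <= payoff u i nu (Smi i h) s].
Proof.
move=> oh sh ne; move: sU; rewrite inE => /andP[_ /existsPn/(_ h)].
have shR : s \in Ri i (SR n) h by rewrite inE sR.
have Rn : Rne i (SR n) h by rewrite /Rne ne andbT; apply/set0Pn; exists s.
rewrite oh eqxx sh Rn /= => /forallPn[Q]; rewrite negb_imply => /andP[/andP[Q0 /subsetP QR]].
move=> /exists_inPn nd.
have [||||nu [nu0 nuQ nuP nub]] := @boergers _ Rl gG i (Ri i (SR n) h) Q s.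
- by move=> t; rewrite inE => /andP[_ /Si_Sset].
- by move=> p /QR; rewrite inE => /andP[_ /Smi_Sminus].
- by [].
- by move=> t /nd.
have WQ t : payoff u i nu (Smi i h) t = payoff u i nu Q t.
  rewrite /payoff [RHS]big_mkcond [LHS]big_mkcond; apply: eq_bigr => p _.
  have [pQ|pQ] := boolP (p \in Q).
    by move: (QR _ pQ); rewrite inE => /andP[_ ->].
  have [->|/nuQ] := eqVneq (nu p) 0; last by rewrite (negbTE pQ).
  by rewrite mul0r if_same.
exists nu; split=> //; first by move=> p /nuQ/QR.
  have [p pQ] := set0Pn _ Q0; apply: (mass_neq0 nu0 _ (nuP _ pQ)).
  by move: (QR _ pQ); rewrite inE => /andP[].
by move=> t tR; rewrite !WQ; apply: nub.
Qed.

(** A sandwich: [t] is matched at [h] by a member of [T], which does no better than [b] under [nu];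
    and [b] lies in [SR n], so it does no better than [s]. *)
Lemma best_Ri_Si L h nu : justifies L (key gG h) -> owner G h = i -> s \in Si i h ->
  ~~ covers L (Smi i h) -> (forall p, 0 <= nu p) -> supported nu (Rmi i (SR n) h) ->
  mass nu (Smi i h) != 0 ->
  (forall t, t \in Ri i (SR n) h -> payoff u i nu (Smi i h) t <= payoff u i nu (Smi i h) s) ->
  forall t, t \in Si i h -> payoff u i nu (Smi i h) t <= payoff u i nu (Smi i h) s.
Proof.
move=> [L0 Lc Lcov Lb] oh sh nch nu0 nuR num nub t th.
(* The profiles charged by [L]: disjoint from every event that [L] does not charge, in particular
   from [Smi i h]. *)
pose P : {set sprof G} :=
  [set p in Sminus i | has (fun nu' : {ffun sprof G -> Rl} => nu' p != 0) L].
have PF E p : ~~ covers L E -> p \in P -> p \notin E.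
  move=> /hasPn nc; rewrite inE => /andP[_ /hasP[nu' nuL nup]].
  by apply: contra (nc _ nuL) => pE; apply: mass_neq0 nup => //; apply: L0.
(* Agreement with [s] on [P] gives members of [T] the payoffs of [s] under every weight of [L]. *)
pose T := [set r in Si i h | [forall p in P, zeta (join i r p) == zeta (join i s p)]].
have TP r : reflect (r \in Si i h /\ forall p, p \in P -> zeta (join i r p) = zeta (join i s p))
    (r \in T).
  rewrite [r \in T]in_set; apply: (iffP andP) => -[rh rP]; split=> //.
    by move=> p pP; apply/eqP; apply: (forall_inP rP).
  by apply/forall_inP => p pP; apply/eqP/rP.
have sT : s \in T by apply/TP.
pose M := nu :: tail i n.
have M0 : nonneg M by move=> nu'; rewrite inE => /orP[/eqP->//|/tail_ge0].
have [|b bT bmax] := @lexmax_exists Rl _ [seq payoff u i nu' (Sminus i) | nu' <- M] T.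
  by apply/set0Pn; exists s.
have /TP[bh bP] := bT; have bS := Si_Sset bh.
have [q qR] : exists q, q \in Rmi i (SR n) h.
  have [q _ /nuR qR] := mass_neq0_ex num; by exists q.
have [qRm qh] := setIP qR.
have bb x : owner G x = i -> b \in Si i x -> best ((rcons L nu) ++ tail i n) b x.
  move=> ox bx t' tx; rewrite cat_rcons sel_cat -/M; case: ifPn => [cov|ncov].
    have [p px nup] := mass_neq0_ex (mass_sel cov).
    have pP : p \in P.
      by rewrite inE (Smi_Sminus px); apply/hasP; exists (sel L (Smi i x)) => //; apply: sel_mem.
    have sx : s \in Si i x.
      apply: (passes_Si sS (Smi_Sminus px)); rewrite -bP//.
      exact: Si_Smi_passes.
    apply: le_trans (Lb _ ox sx cov _ tx) _.
    rewrite le_eqVlt; apply/orP; left; apply/eqP; apply: eq_bigr => p' px'.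
    have [->|np'] := eqVneq (sel L (Smi i x) p') 0; first by rewrite !mul0r.
    rewrite bP// inE (Smi_Sminus px'); apply/hasP; exists (sel L (Smi i x)) => //.
    exact: sel_mem.
  (* [L] does not charge [x]: the deviation [r] from [b] stays in [T], so the lexicographic choice
     of [b] bounds it. *)
  have [r rS rE] := replacement gG ox bx tx.
  have rh : r \in Si i h.
    (* Against a profile reaching [h] but not [x], [r] copies [b]. If there is none, [q] reaches
       both sets, and [x] cannot have the smaller key, as [L] would then charge it. *)
    have [sub|/subsetPn[p ph pnx]] := boolP (Smi i h \subset Smi i x); last first.
      apply: (passes_Si rS (Smi_Sminus ph)); rewrite rE ?(Smi_Sminus ph)// (negbTE pnx).
      exact: Si_Smi_passes.
    have qx := subsetP sub _ qh.
    have rx : r \in Si i x.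
      apply: (passes_Si rS (Smi_Sminus qx)); rewrite rE ?(Smi_Sminus qx)// qx.
      exact: Si_Smi_passes.
    have [hx|xh] := leqP (key gG h) (key gG x).
      by have [+ _] := precedes_sub ox oh bx bh qx qh hx; apply.
    have [Sxh _] := precedes_sub oh ox bh bx qh qx (ltnW xh).
    case/negP: ncov; apply: Lcov => //; first exact: Sxh.
    by apply/set0Pn; exists q; rewrite inE qRm.
  have rT : r \in T.
    apply/TP; split=> // p pP; have pS : p \in Sminus i by move: pP; rewrite inE => /andP[].
    by rewrite rE// (negbTE (PF _ _ ncov pP)) bP.
  rewrite -subr_le0 -(payoff_replace u _ (subxx _) (Smi_sub x) rE) subr_le0.
  apply: lexle_sel => //; first exact: bmax.
  by move=> p pS pnx; rewrite rE// (negbTE pnx).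
have bR : b \in SR n i.
  apply: (best_SRiter (L := rcons L nu)) => //.
  - by move=> nu'; rewrite mem_rcons inE => /orP[/eqP->//|/L0].
  - move=> nu'; rewrite mem_rcons inE => /orP[/eqP->|/Lc//] p /nuR.
    by rewrite inE => /andP[].
have bRi : b \in Ri i (SR n) h by rewrite inE bR.
apply: le_trans (nub _ bRi).
(* Switching from [s] to [t] at [h] changes nothing on [P], which misses [Smi i h]. *)
have [r rS rE] := replacement gG oh sh th.
have rT : r \in T.
  apply/TP; split=> [|p pP].
    apply: (passes_Si rS (Smi_Sminus qh)); rewrite rE ?(Smi_Sminus qh)// qh.
    exact: Si_Smi_passes.
  have pS : p \in Sminus i by move: pP; rewrite inE => /andP[].
  by rewrite rE// (negbTE (PF _ _ nch pP)).
have WS t' : payoff u i nu (Smi i h) t' = payoff u i nu (Sminus i) t'.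
  rewrite /payoff big_mkcond [RHS]big_mkcond; apply: eq_bigr => p _.
  have [ph|pnh] := boolP (p \in Smi i h); first by rewrite (Smi_Sminus ph).
  have [->|/nuR] := eqVneq (nu p) 0; first by rewrite mul0r if_same.
  by rewrite inE (negbTE pnh) andbF.
have Wt : payoff u i nu (Smi i h) t = payoff u i nu (Smi i h) r.
  apply: eq_bigr => p ph; by rewrite rE ?(Smi_Sminus ph)// ph.
by rewrite Wt !WS; have /= [/ltW|[->]] := bmax _ rT.
Qed.

(** Since [key] is injective, each step of the induction concerns at most one information set. *)
Lemma justifies_exists N : exists L, justifies L N.
Proof.
elim: N => [|N [L LP]]; first by exists [::]; split.
have [L0 Lc Lcov Lb] := LP.
have keep : (forall x, owner G x = i -> s \in Si i x -> key gG x = N ->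
    Rmi i (SR n) x != set0 -> covers L (Smi i x)) -> exists L, justifies L N.+1.
  move=> new; exists L; split=> // x ox sx; rewrite ltnS leq_eqVlt => /orP[/eqP|]; first exact: new.
  exact: Lcov.
have [[h [oh sh hN ne nc]]|no] := pselect (exists h, [/\ owner G h = i, s \in Si i h,
    key gG h = N, Rmi i (SR n) h != set0 & ~~ covers L (Smi i h)]); last first.
  apply: keep => x ox sx xN ne; apply: contra_notT no => nc; by exists x.
have [nu [nu0 nuR num nub]] := undominated_best oh sh ne.
rewrite -hN in LP; have nuS := best_Ri_Si LP oh sh nc nu0 nuR num nub.
exists (rcons L nu); rewrite -cats1; split.
- by move=> nu'; rewrite mem_cat inE => /orP[/L0//|/eqP->].
- by move=> nu'; rewrite mem_cat inE => /orP[/Lc//|/eqP-> p /nuR]; rewrite inE => /andP[].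
- move=> x ox sx; rewrite ltnS leq_eqVlt /covers has_cat => /orP[/eqP xN _|xN ne'].
    have -> : x = h by apply: (key_inj (gG := gG)); rewrite xN hN.
    by rewrite /= num orbT.
  by rewrite [has _ L](Lcov _ ox sx xN ne').
move=> x ox sx cov t tx; rewrite sel_cat; case: ifPn => [c|c]; first exact: Lb.
move: cov; rewrite /covers has_cat [has _ L](negbTE c) /= orbF => numx.
rewrite numx.
have [p px nup] := mass_neq0_ex numx.
have /setIP[pR ph] := nuR _ nup.
(* Through [p], [x] is compatible with [SR n]; with a smaller key than [h] it would already be
   charged by [L]. *)
have hx : (key gG h <= key gG x)%N.
  rewrite hN leqNgt; apply: contra c => xN; apply: Lcov => //.
  by apply/set0Pn; exists p; rewrite inE pR.
have [Sxh Pxh] := precedes_sub ox oh sx sh px ph hx.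
(* The deviation at [x] becomes one at [h], where [nuS] applies whether or not [r] lies in
   [SR n]. *)
have [r rS rE] := replacement gG ox sx tx.
have rh : r \in Si i h.
  apply: Sxh; apply: (passes_Si rS (Smi_Sminus px)); rewrite rE ?(Smi_Sminus px)// px.
  exact: Si_Smi_passes.
have xhS : Smi i x \subset Smi i h by apply/subsetP.
rewrite -subr_le0 -(payoff_replace u _ (Smi_sub h) xhS rE) subr_le0; exact: nuS.
Qed.

Lemma Uop_SRop : s \in SR n.+1 i.
Proof.
(* The bound exceeds every key, so no information set is left out. *)
have [L [L0 Lc Lcov Lb]] := justifies_exists (\max_x key gG x).+1.
apply: (SRop_cps (L := L ++ tail i n)) => //.
- exact: nonneg_tail.
- by move=> E; apply: Hsets_covers_cat.
- by move=> x ox ne; apply: sel_tail_supp.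
move=> x ox sx ne t; rewrite inE => /andP[_ tx].
have cov : covers L (Smi i x).
  by apply: Lcov => //; rewrite ltnS; apply: (leq_bigmax (F := fun x => key gG x)).
by rewrite sel_cat cov; apply: Lb.
Qed.

End Player.

(** * The converse inclusion and the equality of the two procedures *)

Lemma SRop_Uop n i s : s \in SRop u (SR n) i -> s \in Uop (SR n) i.
Proof.
rewrite inE => /andP[sR /asboolP[mu [[cps muR] mub]]].
rewrite inE sR; apply/existsPn => x; apply/negP => /and4P[/eqP ox sx ne].
have EH : Smi i x \in Hsets i by apply: imset_f; rewrite inE ox.
have [mu0 mu1 _ _] := cps _ EH; have muRx := muR _ ox ne.
set E := Smi i x in EH mu0 mu1 muRx; set m := mu E in mu0 mu1 muRx.
have RS : Rmi i (SR n) x \subset Sminus i.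
  by apply/subsetP => p; rewrite inE => /andP[/Rminus_Sminus].
have z p : p \in Sminus i -> p \notin Rmi i (SR n) x -> m p = 0.
  move=> pS pR; move: mu1; rewrite /mu_of (big_setID (Rmi i (SR n) x)) /= (setIidPr RS).
  rewrite [X in X + _]muRx => /(canRL (addKr _)); rewrite addNr => z.
  apply: (psumr_eq0P _ z); last by rewrite inE pR.
  by move=> p'; rewrite inE => /andP[_ /mu0].
(* B-dominance is applied to the support of the belief at [x]: a strategy weakly dominating [s]
   there gains strictly at some [q] of positive probability, so its expected utility is larger. *)
move=> /forallP/(_ [set p in Rmi i (SR n) x | m p != 0]).
rewrite (_ : _ != set0) /=; last first.
  apply: contra_eq_neq muRx => Q0; rewrite /mu_of big1 1?eq_sym ?oner_eq0// => p pR.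
  by apply/eqP; apply: contraT => np; have := in_set0 p; rewrite -Q0 in_set pR np.
rewrite (_ : _ \subset _) /=; last by apply/subsetP => p; rewrite !inE => /andP[].
case/exists_inP => t tR /andP[/forall_inP dom /exists_inP[q qQ sq]].
suff : ~~ (EU u i (SR n) mu x t <= EU u i (SR n) mu x s) by rewrite mub.
have tS : t \in Sset i by move: tR; rewrite inE => /andP[_ /Si_Sset].
have sS := Si_Sset sx; rewrite -ltNge.
have qS : q \in Sminus i by apply: (subsetP RS); move: qQ; rewrite inE => /andP[].
have tZ p : p \in Sminus i -> terminal (zeta (join i t p)) by apply: zeta_terminal.
have sZ p : p \in Sminus i -> terminal (zeta (join i s p)) by apply: zeta_terminal.
have uq : u i (zeta (join i s q)) < u i (zeta (join i t q)).
  rewrite ltNge; apply/negP => /(util_ordrep Rl gG i (sZ _ qS) (tZ _ qS)).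
  by move: sq => /andP[_ /negP].
have mq : 0 < m q.
  by rewrite lt_def mu0// andbT; move: qQ; rewrite inE => /andP[].
have qR : q \in Rminus i (SR n) by move: qQ; rewrite !inE -andbA => /andP[].
rewrite /EU (bigD1 q qR) [ltRHS](bigD1 q qR) /=; apply: ltr_leD.
  by rewrite ltr_pM2r.
apply: ler_sum => p /andP[pR _]; have pS := Rminus_Sminus pR.
have [pQ|pQ] := boolP (p \in [set p in Rmi i (SR n) x | m p != 0]).
  apply: ler_wpM2r; first exact: mu0.
  by apply/(util_ordrep Rl gG i (tZ _ pS) (sZ _ pS))/dom.
have -> : mu (Smi i x) p = 0; last by rewrite !mulr0.
apply/eqP; apply: contraNT pQ => np; rewrite in_set np andbT.
by apply: contraNT np => pR'; apply/eqP/z.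
Qed.

Lemma Uiter_SRiter n : Uiter n = SR n.
Proof.
elim: n => [//|n IH]; rewrite /Uiter iterS -/(Uiter n) IH; apply: funext => i.
by apply/setP => s; apply/idP/idP => [/Uop_SRop|/SRop_Uop].
Qed.

End Main.

Theorem theorem3 (G : gdata) (Rl : realType) :
  is_game G ->
  exists u : player G -> hist G -> Rl,
    (forall j, @is_ordrep G Rl j (u j)) /\
    (forall (i : player G) (k : nat), @Uiter G k i = @SRiter G Rl u k i).
Proof.
move=> gG; exists (@util G Rl); split=> [j|i k]; first exact: util_ordrep.
by rewrite (Uiter_SRiter Rl gG).
Qed.
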